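(* Let $X$ be a normed plane with norm $\|\cdot\|$, let $k\ge 0$ be an integer, and let $x_1,\dots,x_{2k+1}\in X$ be unit vectors (i.e. $\|x_i\|=1$ for all $i$, not necessarily distinct). Then there exist signs $\varepsilon_1,\dots,\varepsilon_{2k+1}\in\{\pm 1\}$ such that \[\left\|\sum_{i=1}^{2k+1}\varepsilon_i x_i\right\|\leq 1.\]
   Context: A normed plane is a two-dimensional real normed vector space. *)

(* Defs.v *)
From HB Require Import structures.
From mathcomp Require Import all_boot all_order all_algebra.
From mathcomp Require Import all_classical all_reals all_analysis.

Set Implicit Arguments.
Unset Strict Implicit.
Unset Printing Implicit Defensive.

(* Finite-dimensional normed vector spaces: one vector space structure underlies
   both the norm of [NormedModule] and the dimension [\dim] of [Vector]. *)
#[short(type="normedVectType")]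
HB.structure Definition NormedVector (K : numFieldType) :=
  {V of NormedModule K V & Vector K V}.

(* Main.v *)
(* Replace each x_i by the one of x_i, -x_i lying in a fixed open half-plane, order the
   resulting vectors y_1, ..., y_n by angle and take S = y_1 - y_2 + ... + y_n.  Let u be
   the multiple of S of norm 1 in the closed half-plane (if S <> 0), and f a functional of
   norm 1 with f u = 1, so that |f S| = ||S||.  If y_1, ..., y_m come before u, then
   y_{m+1}, ..., y_n, -y_1, ..., -y_m all lie in the half-turn from u to -u, along which f
   decreases on the unit circle; as n is odd, their alternating sum is S or -S.  The
   alternating sum of an odd number of monotone reals in [-1, 1] is in [-1, 1]. *)
Require Import Defs.
From HB Require Import structures.
From mathcomp Require Import all_boot all_order all_algebra.
From mathcomp Require Import all_classical all_reals all_analysis.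
From mathcomp Require Import ring lra.

Import Order.TTheory GRing.Theory Num.Theory.
Local Open Scope ring_scope.

Set Implicit Arguments.
Unset Strict Implicit.
Unset Printing Implicit Defensive.

(** * Alternating sums *)

Definition altsum (V : zmodType) (s : seq V) : V := foldr (fun x r => x - r) 0 s.

Lemma altsum_cat (V : zmodType) (s t : seq V) :
  altsum (s ++ t) = altsum s + (if odd (size s) then - altsum t else altsum t).
Proof.
elim: s => [|x s IHs] /=; first by rewrite add0r.
by rewrite IHs opprD addrA; case: (odd _); rewrite //= opprK.
Qed.

Lemma altsum_map (V W : zmodType) (f : {additive V -> W}) (s : seq V) :
  altsum (map f s) = f (altsum s).
Proof. by elim: s => [|x s IHs] /=; rewrite ?raddf0 // raddfB IHs. Qed.

(** The entries of [t] move by [size s] places, those of [s] by [size t] places with a change of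
    sign; the two lengths have opposite parity, so all signs change alike. *)
Lemma altsum_rotN (V : zmodType) (s t : seq V) : odd (size (s ++ t)) ->
  altsum (t ++ map -%R s) =
    if odd (size t) then altsum (s ++ t) else - altsum (s ++ t).
Proof.
rewrite size_cat oddD !altsum_cat (altsum_map -%R).
by case: (odd (size s)); case: (odd (size t)) => //= _; rewrite ?opprB ?opprK addrC.
Qed.

Lemma altsum_signs (R : pzRingType) (V : lmodType R) (I : eqType) (y : I -> V)
    (s : seq I) : uniq s ->
  exists eps : I -> R, (forall i, eps i = 1 \/ eps i = -1) /\
    altsum (map y s) = \sum_(i <- s) eps i *: y i.
Proof.
elim: s => [_|a s IHs] /=; first by exists (fun=> 1); split; [left | rewrite big_nil].
case/andP=> a_notin /IHs[eps [eps1 sumE]].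
exists (fun i => if i == a then 1 else - eps i); split=> [i|].
  case: eqP => _; first by left.
  by case: (eps1 i) => ->; [right | left; rewrite opprK].
rewrite big_cons eqxx scale1r sumE -sumrN; congr (_ + _).
apply: eq_big_seq => i i_s; case: eqP => [ia|_]; last by rewrite scaleNr.
by rewrite -ia i_s in a_notin.
Qed.

(** Removing the head swaps the two parities, so both bounds go through one induction;
    [odd (size s)] means an even number of terms in all. *)
Lemma altsum_nonincreasing (R : realDomainType) (x m : R) (s : seq R) :
    pairwise >=%R (x :: s) -> all (>= m) (x :: s) ->
  if odd (size s) then 0 <= altsum (x :: s) <= x - m
  else m <= altsum (x :: s) <= x.
Proof.
elim: s x => [|y s IHs] x; first by rewrite /= subr0 lexx andbT => _ ->.
rewrite pairwise_cons => /andP[/= /andP[yx _] s_dec] /andP[mx s_ge].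
by have := IHs y s_dec s_ge; rewrite /=; case: (odd _) => /= /andP[H1 H2];
  apply/andP; split; lra.
Qed.

Lemma norm_altsum_nonincreasing (R : realDomainType) (s : seq R) :
  odd (size s) -> pairwise >=%R s -> all (fun x => `|x| <= 1) s -> `|altsum s| <= 1.
Proof.
case: s => //= x s odd_s s_dec /andP[x1 s1].
have s_ge : all (>= -1) (x :: s).
  rewrite /=; apply/andP; split; first by move: x1; rewrite ler_norml => /andP[].
  by apply: sub_all s1 => z; rewrite ler_norml => /andP[].
have := altsum_nonincreasing s_dec s_ge.
rewrite (negbTE odd_s) ler_norml => /andP[-> /le_trans->] //.
exact: le_trans (ler_norm _) x1.
Qed.

(** Once [a] holds at an entry, it holds at all later ones, so these entries form a suffix. *)
Lemma pairwise_split_in (T : Type) (P a : pred T) (r : rel T) (s : seq T) :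
    {in P &, forall x y, r x y -> a x -> a y} -> all P s -> pairwise r s ->
  s = [seq x <- s | ~~ a x] ++ [seq x <- s | a x].
Proof.
move=> ar; elim: s => //= x s IHs /andP[Px Ps] /andP[xs /(IHs Ps) sE].
case ax: (a x) => /=; last by rewrite -sE.
have as_ : all a s.
  elim: (s) Ps xs => //= z t IHt /andP[Pz /IHt{}IHt] /andP[xz /IHt->].
  by rewrite (ar x z).
have -> : [seq z <- s | ~~ a z] = [::].
  by elim: (s) as_ => //= z t IHt /andP[-> /IHt].
by rewrite /= (all_filterP _).
Qed.

(** * Determinants in the plane *)

(** The oriented area of [p] and [q] in the coordinates of [b]; its sign compares angles within a
    half-plane. *)
Definition det2 (R : fieldType) (X : vectType R) (b : 2.-tuple X) (p q : X) : R :=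
  coord b 0 p * coord b 1 q - coord b 1 p * coord b 0 q.

Section Det2.
Context {R : fieldType} {X : vectType R} (b : 2.-tuple X).
Local Notation D := (det2 b).

Lemma det2C p q : D p q = - D q p.
Proof. by rewrite /det2; ring. Qed.

Lemma det2_scalar p : scalar (D p).
Proof. by move=> a q r; rewrite /det2 !linearP /=; ring. Qed.

Lemma det2Zl a p q : D (a *: p) q = a * D p q.
Proof. by rewrite /det2 !linearZ /=; ring. Qed.

Lemma det2Dl p q r : D (p + q) r = D p r + D q r.
Proof. by rewrite /det2 !linearD /=; ring. Qed.

Lemma det2Nl p q : D (- p) q = - D p q.
Proof. by rewrite -scaleN1r det2Zl mulN1r. Qed.

Lemma det2Nr p q : D p (- q) = - D p q.
Proof. by rewrite det2C det2Nl -det2C. Qed.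

Lemma det2Zr a p q : D p (a *: q) = a * D p q.
Proof. by rewrite det2C det2Zl (det2C q) mulrN opprK. Qed.

(** Up to sign, the two determinants are the coordinates of [u]. *)
Lemma det2_eq0 (b_basis : basis_of {:X} b) u :
  D (tnth b 0) u = 0 -> D (tnth b 1) u = 0 -> u = 0.
Proof.
rewrite /det2 !(tnth_nth 0) !(coord_free _ _ (basis_free b_basis)) /=.
rewrite !(mul0r, mul1r) subr0 sub0r => c1 /eqP; rewrite oppr_eq0 => /eqP c0.
rewrite (coord_basis b_basis (memvf u)) big_ord_recl big_ord1.
by rewrite (_ : lift _ _ = 1) ?c0 ?c1 ?scale0r ?addr0 //; apply: val_inj.
Qed.

(** Cramer's rule for three vectors of a plane, checked on each coordinate. *)
Lemma det2_plucker (b_basis : basis_of {:X} b) p q r :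
  D p r *: q = D q r *: p + D p q *: r.
Proof.
apply/eqP; rewrite -subr_eq0 [X in X == 0](coord_basis b_basis (memvf _)).
rewrite big1 // => i _; rewrite linearB linearD !linearZ /=.
rewrite (_ : _ - _ = 0) ?scale0r // /det2; case: i => -[|[|//]] /= i2.
  by rewrite (_ : Ordinal _ = 0) //; [ring | apply: val_inj].
by rewrite (_ : Ordinal _ = 1) //; [ring | apply: val_inj].
Qed.

(** Here [f] is a plain function with a linearity proof, so that [det2 b e] can take its place. *)
Lemma det2_plucker_scalar (b_basis : basis_of {:X} b) (f : X -> R) p q r :
  scalar f -> D p r * f q = D q r * f p + D p q * f r.
Proof.
move=> f_lin; pose F : {scalar X} := HB.pack f (GRing.isLinear.Build R X R _ f f_lin).
have := congr1 F (det2_plucker b_basis p q r).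
by rewrite linearD !linearZ.
Qed.

End Det2.

(** Among the vectors b0 + t b1, each [x i] excludes at most the value t = - [c i], so any t larger
    than all the absolute values of the [c i] works. *)
Lemma det2_generic (R : realFieldType) (X : vectType R) (b : 2.-tuple X)
    (b_basis : basis_of {:X} b) (n : nat) (x : 'I_n -> X) :
  (forall i, x i != 0) -> exists e, forall i, det2 b e (x i) != 0.
Proof.
move=> x0; pose c i := det2 b (tnth b 0) (x i) / det2 b (tnth b 1) (x i).
exists (tnth b 0 + (1 + \sum_i `|c i|) *: tnth b 1) => i.
rewrite det2Dl det2Zl; have [d1|d1] := eqVneq (det2 b (tnth b 1) (x i)) 0.
  by rewrite d1 mulr0 addr0; apply: contra_neq (x0 i) => /(det2_eq0 b_basis)->.
have ci_le : `|c i| <= \sum_j `|c j|.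
  by rewrite (bigD1 i) //= lerDl sumr_ge0.
apply/eqP => d0; have ciE : c i = - (1 + \sum_i `|c i|).
  by apply: (mulIf d1); rewrite divfK // mulNr; apply/eqP; rewrite -addr_eq0 d0.
by have := ler_norm (- c i); rewrite normrN; lra.
Qed.

(** * Norming functionals *)

(* One-step Hahn-Banach: c is the value at w of a norming functional of u. *)
Lemma norming_coef (R : realType) (X : normedModType R) (u w : X) : `|u| = 1 ->
  exists c : R, forall s t : R, `|s + c * t| <= `|s *: u + t *: w|.
Proof.
move=> u1; pose E := [set s - `|s *: u - w| | s in setT]%classic.
(* The value at [w] must lie above [E] and below all these bounds; the triangle inequality separates
   the two families. *)
have E_ub (s : R) : ubound E (`|s *: u + w| - s).
  move=> _ [t _ <-]; rewrite lerBrDr addrAC lerBlDr.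
  apply: le_trans (ler_normD _ _); rewrite addrACA subrr addr0 -scalerDl.
  by rewrite normrZ u1 mulr1 addrC ler_norm.
have E0 : (E !=set0)%classic by exists (0 - `|0 *: u - w|), 0.
have supE_ge (t : R) : t - `|t *: u - w| <= sup E.
  by apply: ub_le_sup; [exists (`|0 *: u + w| - 0); exact: E_ub | exists t].
have supE_le (s : R) : sup E <= `|s *: u + w| - s by apply: ge_sup => //; exact: E_ub.
have normE (s t : R) : t != 0 -> `|s *: u + t *: w| = `|t| * `|(s / t) *: u + w|.
  by move=> t0; rewrite -normrZ scalerDr scalerA mulrC divfK.
have le_norm (s t : R) : s + sup E * t <= `|s *: u + t *: w|.
  have [t0|t0|->] := ltgtP t 0; last first.
  - by rewrite mulr0 scale0r !addr0 normrZ u1 mulr1 ler_norm.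
  - have := supE_le (s / t); rewrite normE ?gt_eqF// gtr0_norm // -(ler_pM2r t0).
    by rewrite mulrBl divfK ?gt_eqF//; lra.
  - have := supE_ge (- (s / t)); rewrite -normrN opprB scaleNr opprK (addrC w) normE ?lt_eqF//.
    rewrite ltr0_norm // -(ler_nM2r t0) mulrBl mulNr divfK ?lt_eqF//.
    lra.
exists (sup E) => s t; rewrite ler_norml le_norm andbT.
by have := le_norm (- s) (- t); rewrite !scaleNr -opprD normrN; lra.
Qed.

Lemma norming_functional (R : realType) (X : normedVectType R) (b : 2.-tuple X)
    (b_basis : basis_of {:X} b) (u : X) : `|u| = 1 ->
  exists f : {scalar X}, f u = 1 /\ forall v, `|f v| <= `|v|.
Proof.
move=> u1; have u0 : u != 0 by rewrite -normr_eq0 u1 oner_eq0.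
have [w uw0] : exists w, det2 b u w != 0.
  apply: contrapT => /forallNP uw; case/negP: u0; apply/eqP.
  by apply: (det2_eq0 b_basis); apply/eqP; rewrite det2C oppr_eq0; apply/negbNE/negP/uw.
have [c c_le] := norming_coef w u1.
(* The linear map sending [u] to 1 and [w] to [c], written with Cramer's coefficients. *)
pose f v := (det2 b v w + c * det2 b u v) / det2 b u w.
have f_scalar : scalar f.
  move=> a p q; rewrite /f det2_scalar det2Dl det2Zl /=; field.
  exact: uw0.
pose fL := GRing.isLinear.Build R X R _ f f_scalar.
pose F : {scalar X} := HB.pack f fL.
exists F; split=> [|v]; rewrite /= /f.
  by rewrite (_ : det2 b u u = 0) ?mulr0 ?addr0 ?divff // /det2; ring.
have vE : v = (det2 b v w / det2 b u w) *: u + (det2 b u v / det2 b u w) *: w.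
  apply: (scalerI uw0); rewrite scalerDr !scalerA ![det2 b u w * _]mulrC !divfK //.
  exact: det2_plucker.
rewrite {3}vE (_ : _ / _ = det2 b v w / det2 b u w + c * (det2 b u v / det2 b u w)) //.
by rewrite mulrDl mulrA.
Qed.

(** * Angular order and the norm *)

Section Angle.
Context {R : realType} {X : normedVectType R} (b : 2.-tuple X).
Context (b_basis : basis_of {:X} b).
Local Notation D := (det2 b).

(** Apply [D e] to the Pluecker relation and divide by [D e q]. The outer vectors may lie on the
    boundary line, as [u] may below. *)
Lemma det2_ge0_trans e p q r : 0 <= D e p -> 0 < D e q -> 0 <= D e r ->
  0 <= D p q -> 0 <= D q r -> 0 <= D p r.
Proof.
move=> ep eq er pq qr; rewrite -(pmulr_lge0 (D p r) eq).
rewrite (det2_plucker_scalar b_basis p q r (det2_scalar b e)).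
by rewrite addr_ge0 ?mulr_ge0.
Qed.

(** The Pluecker relation equates a multiple of [p] with one of [q], and comparing norms shows that
    the coefficients agree. *)
Lemma det2_eq0_unit e p q : `|p| = 1 -> `|q| = 1 -> 0 <= D e p -> 0 < D e q ->
  D p q = 0 -> p = q.
Proof.
move=> p1 q1 ep eq pq; have E := det2_plucker b_basis e p q.
rewrite pq scale0r add0r in E.
have := congr1 Num.norm E; rewrite !normrZ p1 q1 !mulr1 (ger0_norm ep) (gtr0_norm eq) => epq.
by move: E; rewrite -epq => /(scalerI (lt0r_neq0 eq)).
Qed.

(** The Pluecker relation under [f] gives [D u q * (f p - f q) = D p q + (D u p - D u q) * f q]. The
    triangle inequality in the same relation gives [|D u p - D u q| <= D p q], and [|f q| <= 1]. *)
Lemma norming_antitone (f : {scalar X}) u p q :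
    `|u| = 1 -> f u = 1 -> (forall v, `|f v| <= `|v|) -> `|p| = 1 -> `|q| = 1 ->
  0 <= D u p -> 0 < D u q -> 0 <= D p q -> f q <= f p.
Proof.
move=> u1 fu f_le p1 q1 up uq pq.
have f_lin : scalar f by move=> a v w; rewrite linearP.
have := det2_plucker_scalar b_basis u p q f_lin; rewrite fu mulr1 => fE.
have pE := det2_plucker b_basis u p q.
have le1 : D u p <= D u q + D p q.
  have := ler_normB (D u q *: p) (D p q *: u).
  by rewrite pE addrAC subrr add0r -pE !normrZ u1 p1 q1 !mulr1 !ger0_norm // ltW.
have le2 : D u q <= D u p + D p q.
  have := ler_normD (D u p *: q) (D p q *: u).
  by rewrite addrC -pE !normrZ u1 p1 q1 !mulr1 !ger0_norm // ltW.
have : `|(D u p - D u q) * f q| <= D p q.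
  rewrite normrM -[leRHS]mulr1 ler_pM // -?q1 ?f_le // ler_norml; lra.
rewrite ler_norml => /andP[le3 _]; rewrite -subr_ge0 -(pmulr_rge0 _ uq); lra.
Qed.

Lemma norm_altsum_le1 e (s : seq X) :
    all [pred y | (`|y| == 1) && (0 < D e y)] s ->
    pairwise (fun p q => 0 <= D p q) s -> odd (size s) ->
  `|altsum s| <= 1.
Proof.
set P := [pred y | _] => sP s_sorted s_odd; pose S := altsum s.
have [->|S0] := eqVneq (altsum s) 0; first by rewrite normr0.
have S0n : 0 < `|S| by rewrite normr_gt0.
have [u [u1 eu [c Su]]] : exists u, [/\ `|u| = 1, 0 <= D e u &
    exists c, `|c| = `|S| /\ S = c *: u].
  pose v := `|S|^-1 *: S.
  have v1 : `|v| = 1 by rewrite normrZ gtr0_norm ?invr_gt0 // mulVf ?gt_eqF.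
  have SE : S = `|S| *: v by rewrite scalerA divff ?scale1r ?gt_eqF.
  have [ev|/ltW ev] := lerP 0 (D e v).
    by exists v; split=> //; exists `|S|; rewrite normr_id.
  exists (- v); rewrite normrN det2Nr oppr_ge0; split=> //.
  by exists (- `|S|); rewrite normrN normr_id scaleNr scalerN opprK.
have [f [fu f_le]] := norming_functional b_basis u1.
have -> : `|altsum s| = `|f S|.
  by case: Su => cS SE; rewrite -/S -cS SE linearZ /= fu mulr1.
(* The vectors not before [u] form a suffix of [s], by transitivity of the angular order. *)
have sE : s = [seq y <- s | ~~ (0 <= D u y)] ++ [seq y <- s | 0 <= D u y].
  apply: (pairwise_split_in _ sP s_sorted) => p q /andP[_ ep] /andP[_ eq] pq up.
  exact: det2_ge0_trans eu ep (ltW eq) up pq.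
set s1 := [seq y <- s | ~~ _] in sE; set s2 := [seq y <- s | _] in sE.
have -> : `|f S| = `|altsum (map f (s2 ++ map -%R s1))|.
  rewrite altsum_map altsum_rotN -sE //; case: (odd (size s2)) => //.
  by rewrite raddfN normrN.
have s1P y : y \in s1 -> [/\ `|y| = 1, 0 < D e y & 0 < D u (- y)].
  rewrite mem_filter -ltNge => /andP[uy /(allP sP)/andP[/eqP y1 ey]].
  by rewrite det2Nr oppr_gt0.
have s2P y : y \in s2 -> [/\ `|y| = 1, 0 < D e y & 0 <= D u y].
  by rewrite mem_filter => /andP[uy /(allP sP)/andP[/eqP y1 ey]].
apply: norm_altsum_nonincreasing.
- by rewrite size_map size_cat size_map addnC -size_cat -sE.
- rewrite pairwise_map pairwise_cat pairwise_map; apply/and3P; split.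
  (* Since [q] precedes [p] in [s], [- q] follows [p]. *)
  + apply/allrelP => p _ ps2 /mapP[q qs1 ->].
    have [p1 _ up] := s2P p ps2; have [q1 _ uq] := s1P q qs1.
    apply: (norming_antitone u1 fu f_le) => //; first by rewrite normrN.
    rewrite det2Nr -det2C; move: s_sorted; rewrite sE pairwise_cat => /and3P[/allrelP pq _ _].
    exact: pq.
  + apply: (@sub_in_pairwise _ (mem s2) (fun p q => 0 <= D p q)); last 2 first.
    * by apply/allP.
    * exact: pairwise_filter.
    move=> p q /s2P[p1 ep up] /s2P[q1 eq uq] pq /=.
    (* If [D u q = 0] then [q = u], and [p], lying between [u] and [q], equals [u] too. *)
    have [uq0|uq0] := eqVneq 0 (D u q); last first.
      by apply: (norming_antitone u1 fu f_le); rewrite // lt_neqAle uq0.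
    have uqE := det2_eq0_unit u1 q1 eu eq (esym uq0).
    have up0 : D u p = 0.
      by apply/eqP; rewrite eq_le up andbT uqE det2C oppr_le0.
    by rewrite -(det2_eq0_unit u1 p1 eu ep up0) -uqE.
  + apply: (@sub_in_pairwise _ (mem s1) (fun p q => 0 <= D p q)); last 2 first.
    * by apply/allP.
    * exact: pairwise_filter.
    move=> p q /s1P[p1 ep up] /s1P[q1 eq uq] pq /=.
    apply: (norming_antitone u1 fu f_le); rewrite ?normrN ?(ltW up) //.
    by rewrite det2Nl det2Nr opprK.
- rewrite all_map; apply/allP => y; rewrite mem_cat => /orP[/s2P[<- _ _]|].
    exact: f_le.
  by case/mapP=> z /s1P[<- _ _] ->; rewrite -(normrN z); exact: f_le.
Qed.
End Angle.

Theorem theorem2 (R : realType) (X : normedVectType R)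
    (dimX : \dim {: X}%VS = 2%N) (k : nat) (x : 'I_(2 * k + 1) -> X)
    (x_unit : forall i, `|x i| = 1) :
  exists eps : 'I_(2 * k + 1) -> R,
    (forall i, eps i = 1 \/ eps i = -1) /\
    `|\sum_(i < 2 * k + 1) eps i *: x i| <= 1.
Proof.
have [b b_basis] : exists b : 2.-tuple X, basis_of {:X} b.
  by move: (vbasis {:X}) (vbasisP {:X}); rewrite dimX => b; exists b.
have x0 i : x i != 0 by rewrite -normr_eq0 x_unit oner_eq0.
have [e ex] := det2_generic b_basis x0.
pose sg i : R := Num.sg (det2 b e (x i)); pose y i := sg i *: x i.
have y1 i : `|y i| = 1 by rewrite normrZ x_unit mulr1 normr_sg ex.
have ey i : 0 < det2 b e (y i) by rewrite det2Zr -normrEsg normr_gt0.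
(* Indices are sorted rather than vectors, since vectors may repeat while [altsum_signs] asks for a
   list without repetition. *)
pose le i j := 0 <= det2 b (y i) (y j); pose s := sort le (enum 'I_(2 * k + 1)).
have s_sorted : pairwise le s.
  (* Transitivity of [le], which makes a sorted list pairwise ordered, holds because all [y i] lie
     in one open half-plane. *)
  rewrite -(@sorted_pairwise_in _ predT) ?all_predT //.
    apply: sort_sorted => i j; rewrite /le (det2C b (y j)) oppr_ge0.
    exact: le_total.
  by move=> j i l _ _ _; apply: (det2_ge0_trans b_basis (e := e)); rewrite // ltW.
have s_uniq : uniq s by rewrite sort_uniq enum_uniq.
have [eps [eps1 sumE]] := altsum_signs y s_uniq.
exists (fun i => eps i * sg i); split=> [i|].
  rewrite /sg; case: sgrP (ex i); rewrite ?eqxx // => _ _;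
  by case: (eps1 i) => ->; rewrite ?mulrN ?mulr1 ?opprK; auto.
rewrite (_ : \sum_i _ = altsum (map y s)); last first.
  rewrite sumE [RHS](perm_big (enum 'I_(2 * k + 1))) /=; last exact/permPl/perm_sort.
  by rewrite big_enum; apply: eq_bigr => i _; rewrite scalerA.
apply: (norm_altsum_le1 b_basis (e := e)).
- by rewrite all_map; apply/allP => i _ /=; rewrite y1 eqxx ey.
- by rewrite pairwise_map.
- by rewrite size_map size_sort size_enum_ord oddD mul2n odd_double.
Qed.
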